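(* Let $M$ be a maximal translation surface in $\mathbb{L}^3$ parametrized by $X(s,t)=\alpha(s)+\beta(t)$, where both generating curves $\alpha$ and $\beta$ are pseudo-null curves. Then $M$ is a plane, or $\alpha=\beta$, or, after a rigid motion, $$\alpha(s)=e^{ks}(0,1,1)+s(1,b,b),\qquad \beta(t)=e^{kt}(w_1,w_2,w_3)-t(1,b,b),$$ where $k,b,w_1,w_2,w_3\in\mathbb{R}$, $k\ne0$, $w_2-w_3\neq0$ and $$w_1=b(w_3-w_2),\qquad b^2(w_2-w_3)+w_2+w_3=0.$$
   Context: $\mathbb{L}^3$ is $\mathbb{R}^3$ with the metric $\langle\cdot,\cdot\rangle=dx^2+dy^2-dz^2$. A vector $v$ is spacelike if $\langle v,v\rangle>0$ or $v=0$, lightlike if $\langle v,v\rangle=0$ and $v\ne0$. A rigid motion is an affine isometry of $\mathbb{L}^3$. A translation surface is parametrized by $X(s,t)=\alpha(s)+\beta(t)$ with $\alpha:I\to\mathbb{L}^3$, $\beta:J\to\mathbb{L}^3$ smooth curves (the generating curves) and $\alpha'(s),\beta'(t)$ linearly independent for all $s,t$. A surface is spacelike if its induced metric is Riemannian, and maximal if it is spacelike with mean curvature $H=0$ everywhere; for generating curves parametrized by arc length, $H=0$ reads $\det(\alpha',\beta',\alpha'')+\det(\alpha',\beta',\beta'')=0$. A pseudo-null curve is a spacelike curve parametrized by arc length whose second derivative is everywhere lightlike (and nonzero). Results are local (''is a plane'' means contained in a plane); generating curves are considered up to translation and up to translation and reversal of the arc-length parameter. *)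

(* Defs.v *)
From HB Require Import structures.
From mathcomp Require Import all_boot all_order all_algebra.
From mathcomp Require Import all_classical all_reals all_analysis.

Set Implicit Arguments.
Unset Strict Implicit.
Unset Printing Implicit Defensive.

Import Order.TTheory GRing.Theory Num.Theory.
Import numFieldNormedType.Exports.

Local Open Scope ring_scope.
Local Open Scope classical_set_scope.

Section Lorentz.
Variable R : realType.
Implicit Types (u v w : 'rV[R]_3).

Definition vec3 (x y z : R) : 'rV[R]_3 := \row_(i < 3) [:: x; y; z]`_i.

(* In 'I_3 the numerals 0, 1, 2 are the indices of the coordinates x, y, z. *)
Definition lprod u v : R := u 0 0 * v 0 0 + u 0 1 * v 0 1 - u 0 2 * v 0 2.

Definition lightlike v : Prop := lprod v v = 0 /\ v <> 0.

(* Characterized by lprod (lcross u v) w = det (u, v, w) for all w. *)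
Definition lcross u v : 'rV[R]_3 :=
  vec3 (u 0 1 * v 0 2 - u 0 2 * v 0 1)
       (u 0 2 * v 0 0 - u 0 0 * v 0 2)
       (- (u 0 0 * v 0 1 - u 0 1 * v 0 0)).

Definition rigid_motion (Phi : 'rV[R]_3 -> 'rV[R]_3) : Prop :=
  exists (A : 'M[R]_3) (p : 'rV[R]_3),
    (forall u v, lprod (u *m A) (v *m A) = lprod u v) /\
    (forall u, Phi u = u *m A + p).

End Lorentz.

Section Curves.
Variable R : realType.
Implicit Types (I J : set R) (a b : R -> 'rV[R]_3).

(* Curves are total functions of which only the values on the parameter
   interval matter; that interval is open, so derivatives at its points are
   determined by these values. *)
Definition open_interval I : Prop := [/\ open I, is_interval I & I !=set0].

Definition smooth_on I a : Prop :=
  forall (n : nat) (s : R), I s -> derivable (derive1n n a) s 1.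

Definition pseudo_null I a : Prop :=
  [/\ smooth_on I a,
      forall s, I s -> lprod (derive1 a s) (derive1 a s) = 1
    & forall s, I s -> lightlike (derive1n 2 a s)].

(* Equality of curves parametrized by arc length, up to a translation of the
   ambient space and the changes of arc-length parameter s |-> +s + c and
   s |-> -s + c; the parameter intervals correspond to each other. *)
Definition same_curve I a J b : Prop :=
  exists (e c : R) (p : 'rV[R]_3),
    [/\ e = 1 \/ e = -1,
        forall s, I s <-> J (e * s + c)
      & forall s, I s -> b (e * s + c) = a s + p].

End Curves.

Section Surfaces.
Variable R : realType.
Implicit Types (I J : set R) (a b : R -> 'rV[R]_3) (X : R -> R -> 'rV[R]_3).

Definition d_s X : R -> R -> 'rV[R]_3 := fun s t => derive1 (fun x => X x t) s.
Definition d_t X : R -> R -> 'rV[R]_3 := fun s t => derive1 (X s) t.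

Definition fundE X s t : R := lprod (d_s X s t) (d_s X s t).
Definition fundF X s t : R := lprod (d_s X s t) (d_t X s t).
Definition fundG X s t : R := lprod (d_t X s t) (d_t X s t).

(* Timelike, with lprod N N = -1 at the points where X is spacelike, since
   lprod (lcross u v) (lcross u v) =
     lprod u v ^+ 2 - lprod u u * lprod v v. *)
Definition unit_normal X s t : 'rV[R]_3 :=
  (Num.sqrt (fundE X s t * fundG X s t - fundF X s t ^+ 2))^-1
    *: lcross (d_s X s t) (d_t X s t).

Definition sfunde X s t : R := lprod (unit_normal X s t) (d_s (d_s X) s t).
Definition sfundf X s t : R := lprod (unit_normal X s t) (d_t (d_s X) s t).
Definition sfundg X s t : R := lprod (unit_normal X s t) (d_t (d_t X) s t).

(* The leading sign is lprod N N = -1 of a spacelike surface. *)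
Definition mean_curvature X s t : R :=
  - ((sfunde X s t * fundG X s t - 2 * sfundf X s t * fundF X s t
      + sfundg X s t * fundE X s t)
     / (2 * (fundE X s t * fundG X s t - fundF X s t ^+ 2))).

Definition spacelike_surface I J X : Prop :=
  forall s t, I s -> J t -> forall x y : R, (x, y) <> (0, 0) ->
    let v := x *: d_s X s t + y *: d_t X s t in 0 < lprod v v.

Definition maximal_surface I J X : Prop :=
  spacelike_surface I J X /\
  forall s t, I s -> J t -> mean_curvature X s t = 0.

Definition planar_surface I J X : Prop :=
  exists (p : 'rV[R]_3) (U : {vspace 'rV[R]_3}),
    \dim U = 2 /\ forall s t, I s -> J t -> X s t - p \in U.

Definition generating_curves I J a b : Prop :=
  [/\ smooth_on I a, smooth_on J b
    & forall s t, I s -> J t -> free [:: derive1 a s; derive1 b t]].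

Definition translation_surface a b : R -> R -> 'rV[R]_3 :=
  fun s t => a s + b t.

End Surfaces.

(* Main.v *)
Require Import Defs.
From HB Require Import structures.
From mathcomp Require Import all_boot all_order all_algebra.
From mathcomp Require Import all_classical all_reals all_analysis.
From mathcomp Require Import ring lra.

(**
The second derivative of a pseudo-null curve has a constant direction: if T is
the velocity and N the acceleration, differentiating <T,T> = 1, <N,N> = 0 and
<T,N> = 0 shows that N' is orthogonal to T and to N, and since T is spacelike
the orthogonal complement of {T, N} is the null line of N. Hence the velocities
of the generating curves are T0 + F(s) n and S0 + K(t) m, where n and m are
fixed lightlike vectors and F', K' do not vanish
([pseudo_null_velocity]).

If <n,m> = 0, then n and m are parallel and both velocities lie in the
degenerate plane orthogonal to n, so that the surface is not spacelike
([lightlike_orth_gram]). Thus n and m are independent, and the plane that they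
span is Lorentzian; its orthogonal complement is a line spanned by a unit
vector E. Absorbing the components of T0 along n and of S0 along m into F and K
turns the velocities into E + F n and - e E + K m with e = 1 or e = -1. In this
frame the equation H = 0 becomes F' K = e F K'. Neither F nor K can vanish
identically, so the variables separate and F, K are the exponentials
A exp(k s) and B exp(e k t) ([separated_exponentials]).

Integrating, alpha is a translate of s E + exp(k s) n' and, in the parameter
u = e t, beta is a translate of - u E + exp(k u) m', where n' and m' are
multiples of n and m. A linear isometry takes (E, n', m') to (1,0,0), (0,1,1)
and (0,h,-h) with h = <n',m'>/2 ([lorentz_frame]). This is the third
alternative with b = 0, which therefore holds for all the surfaces considered.
*)

Set Implicit Arguments.
Unset Strict Implicit.
Unset Printing Implicit Defensive.

Import Order.TTheory GRing.Theory Num.Theory.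
Import numFieldNormedType.Exports.

Local Open Scope ring_scope.
Local Open Scope classical_set_scope.

(** * The Lorentzian product and null vectors *)

Lemma ord3P (i : 'I_3) : [\/ i = 0, i = 1 | i = 2].
Proof.
by case: i => -[|[|[|//]]] lti;
  [apply: Or31|apply: Or32|apply: Or33]; apply: val_inj.
Qed.

Lemma row3P (R : realType) (u v : 'rV[R]_3) :
  u 0 0 = v 0 0 -> u 0 1 = v 0 1 -> u 0 2 = v 0 2 -> u = v.
Proof. by move=> *; apply/rowP => i; case: (ord3P i) => ->. Qed.

Lemma sum3 (R : realType) (F : 'I_3 -> R) : \sum_i F i = F 0 + F 1 + F 2.
Proof.
rewrite !big_ord_recl big_ord0 addr0 addrA.
by congr (F _ + F _ + F _); apply: val_inj.
Qed.

Lemma lprodC (R : realType) (u v : 'rV[R]_3) : lprod u v = lprod v u.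
Proof. by rewrite /lprod; ring. Qed.

Lemma lprodDl (R : realType) (u v w : 'rV[R]_3) :
  lprod (u + v) w = lprod u w + lprod v w.
Proof. by rewrite /lprod !mxE; ring. Qed.

Lemma lprodZl (R : realType) (x : R) (u v : 'rV[R]_3) :
  lprod (x *: u) v = x * lprod u v.
Proof. by rewrite /lprod !mxE; ring. Qed.

Lemma lprodDr (R : realType) (u v w : 'rV[R]_3) :
  lprod w (u + v) = lprod w u + lprod w v.
Proof. by rewrite lprodC lprodDl !(lprodC w). Qed.

Lemma lprodZr (R : realType) (x : R) (u v : 'rV[R]_3) :
  lprod v (x *: u) = x * lprod v u.
Proof. by rewrite lprodC lprodZl lprodC. Qed.

Definition lprodE := (lprodDl, lprodDr, lprodZl, lprodZr).

Lemma lightlike_coord2_neq0 (R : realType) (n : 'rV[R]_3) : lightlike n -> n 0 2 != 0.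
Proof.
move=> [nn n0]; apply/eqP => n2; apply: n0; move: nn.
rewrite /lprod n2 mulr0 subr0 => nn.
by apply: row3P; rewrite ?n2 mxE //; nra.
Qed.

(** On the degenerate plane orthogonal to a null vector n, the product has rank
    one: the equations of n, u and v express the products of the last
    coordinates through the first two, and what remains is the product of
    the values at u and v of one linear form. *)
Lemma lprod_orth_lightlike (R : realType) (n u v : 'rV[R]_3) :
  lprod n n = 0 -> lprod u n = 0 -> lprod v n = 0 ->
  n 0 2 ^+ 2 * lprod u v =
  (n 0 1 * u 0 0 - n 0 0 * u 0 1) * (n 0 1 * v 0 0 - n 0 0 * v 0 1).
Proof.
rewrite /lprod => nn un vn.
have -> : n 0 2 ^+ 2 * (u 0 0 * v 0 0 + u 0 1 * v 0 1 - u 0 2 * v 0 2) =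
  n 0 2 ^+ 2 * (u 0 0 * v 0 0 + u 0 1 * v 0 1)
  - (u 0 2 * n 0 2) * (v 0 2 * n 0 2) by ring.
have -> : u 0 2 * n 0 2 = u 0 0 * n 0 0 + u 0 1 * n 0 1 by lra.
have -> : v 0 2 * n 0 2 = v 0 0 * n 0 0 + v 0 1 * n 0 1 by lra.
have -> : n 0 2 ^+ 2 = n 0 0 ^+ 2 + n 0 1 ^+ 2 by lra.
by ring.
Qed.

(** The kernel of that linear form on the plane orthogonal to n is the line
    of n. *)
Lemma orth_lightlike_colinear (R : realType) (n v : 'rV[R]_3) :
  lightlike n -> lprod v n = 0 -> n 0 1 * v 0 0 - n 0 0 * v 0 1 = 0 ->
  n 0 2 *: v = v 0 2 *: n.
Proof.
move=> nl vn v12; have n2 := lightlike_coord2_neq0 nl; case: nl => nn _.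
have vn' : v 0 2 * n 0 2 = v 0 0 * n 0 0 + v 0 1 * n 0 1.
  by move: vn; rewrite /lprod; lra.
have n22 : n 0 2 ^+ 2 = n 0 0 ^+ 2 + n 0 1 ^+ 2 by move: nn; rewrite /lprod; lra.
apply: row3P; rewrite !mxE; apply: (mulfI n2).
- transitivity (n 0 2 ^+ 2 * v 0 0); first by ring.
  transitivity (v 0 2 * n 0 2 * n 0 0); last by ring.
  rewrite n22 vn'; apply/eqP; rewrite -subr_eq0; apply/eqP.
  transitivity (n 0 1 * (n 0 1 * v 0 0 - n 0 0 * v 0 1)); first by ring.
  by rewrite v12 mulr0.
- transitivity (n 0 2 ^+ 2 * v 0 1); first by ring.
  transitivity (v 0 2 * n 0 2 * n 0 1); last by ring.
  rewrite n22 vn'; apply/eqP; rewrite -subr_eq0; apply/eqP.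
  transitivity (- n 0 0 * (n 0 1 * v 0 0 - n 0 0 * v 0 1)); first by ring.
  by rewrite v12 mulr0.
- by ring.
Qed.

(** The linear form does not vanish at T because <T,T> is nonzero, so it
    vanishes at v. *)
Lemma orth_lightlike_unit_colinear (R : realType) (n T v : 'rV[R]_3) :
  lightlike n -> lprod T n = 0 -> lprod T T != 0 ->
  lprod v n = 0 -> lprod v T = 0 -> n 0 2 *: v = v 0 2 *: n.
Proof.
move=> nl Tn TT vn vT; have n2 := lightlike_coord2_neq0 nl; have [nn _] := nl.
apply: orth_lightlike_colinear => //.
have := lprod_orth_lightlike nn vn Tn; rewrite vT mulr0 => /esym/eqP.
rewrite mulf_eq0 => /orP[/eqP//|/eqP T12].
have := lprod_orth_lightlike nn Tn Tn; rewrite T12 mulr0 => /eqP.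
by rewrite mulf_eq0 (negPf TT) orbF sqrf_eq0 (negPf n2).
Qed.

(** Orthogonal lightlike vectors are parallel, so T and S lie in one degenerate
    plane, where the Gram determinant of any two vectors is zero. *)
Lemma lightlike_orth_gram (R : realType) (n m T S : 'rV[R]_3) :
  lightlike n -> lightlike m -> lprod n m = 0 ->
  lprod T n = 0 -> lprod S m = 0 ->
  lprod T S ^+ 2 = lprod T T * lprod S S.
Proof.
move=> nl ml nm Tn Sm.
have n2 := lightlike_coord2_neq0 nl; have m2 := lightlike_coord2_neq0 ml.
have [nn _] := nl; have [mm _] := ml.
have Sn : lprod S n = 0.
  have := lprod_orth_lightlike mm nm nm; rewrite nn mulr0 => /esym/eqP.
  rewrite mulf_eq0 orbb => /eqP /(orth_lightlike_colinear ml nm) nm2.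
  by apply: (mulfI m2); rewrite -lprodZr nm2 lprodZr Sm !mulr0.
have sq_inj (x : R) : n 0 2 ^+ 2 * x = 0 -> x = 0.
  by move/eqP; rewrite mulf_eq0 sqrf_eq0 (negPf n2) /= => /eqP.
have TS := lprod_orth_lightlike nn Tn Sn.
have TT := lprod_orth_lightlike nn Tn Tn.
have SS := lprod_orth_lightlike nn Sn Sn.
apply/eqP; rewrite -subr_eq0; apply/eqP/sq_inj/sq_inj.
transitivity ((n 0 2 ^+ 2 * lprod T S) ^+ 2
  - (n 0 2 ^+ 2 * lprod T T) * (n 0 2 ^+ 2 * lprod S S)); first by ring.
by rewrite TS TT SS; ring.
Qed.

(** The squared determinant of three vectors is minus their Gram determinant,
    the metric having determinant -1. *)
Lemma lcross_gram (R : realType) (u v w : 'rV[R]_3) :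
  lprod (lcross u v) w ^+ 2 =
  lprod u u * lprod v w ^+ 2 + lprod v v * lprod u w ^+ 2
  + lprod w w * lprod u v ^+ 2 - lprod u u * lprod v v * lprod w w
  - 2 * lprod u v * lprod v w * lprod u w.
Proof. by rewrite /lcross /vec3 /lprod !mxE /=; ring. Qed.

(** The equation H = 0 for velocities and accelerations written in a frame
    (E, n, m): only two of the determinants in its expansion survive. *)
Lemma lcross_frame (R : realType) (E n m : 'rV[R]_3) (x y s : R) u v :
  lprod (lcross (E + x *: n) (s *: E + y *: m)) (u *: n + v *: m) =
  (y * u + s * x * v) * lprod (lcross E m) n.
Proof. by rewrite /lcross /vec3 /lprod !mxE /=; ring. Qed.

(** * Isometries adapted to a frame *)

(** The Gram matrix of the metric, through which orthonormality of a frame is a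
    matrix identity. *)
Definition lorentz_gram (R : realType) : 'M[R]_3 := diag_mx (vec3 1 1 (-1)).

Lemma lorentz_gramEr (R : realType) (u v : 'rV[R]_3) :
  (u *m lorentz_gram R *m v^T) 0 0 = lprod u v.
Proof.
by rewrite mxE sum3 /lorentz_gram mul_mx_diag !mxE /= /lprod; ring.
Qed.

Lemma lorentz_gramE (R : realType) (M N : 'M[R]_3) i j :
  (M *m lorentz_gram R *m N^T) i j = lprod (row i M) (row j N).
Proof.
rewrite mxE sum3 /lorentz_gram mul_mx_diag !mxE /= /lprod !mxE.
by ring.
Qed.

Lemma lorentz_gram_sqr (R : realType) :
  lorentz_gram R *m lorentz_gram R = 1%:M.
Proof.
apply/matrixP => i j; rewrite mul_mx_diag !mxE.
by case: (ord3P i) => ->; case: (ord3P j) => ->; rewrite /= ?mulr0n ?mulr1n; lra.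
Qed.

(** The matrix B of the rows E, n/2 + m/g, n/2 - m/g, with g = <n,m>, satisfies
    B eta B^T = eta for the Gram matrix eta of the metric, and so B^T eta B = eta
    as well. Its inverse eta B^T eta is therefore an isometry and takes the three
    rows to the standard basis. *)
Lemma lorentz_frame (R : realType) (E n m : 'rV[R]_3) :
  lprod E E = 1 -> lprod E n = 0 -> lprod E m = 0 ->
  lprod n n = 0 -> lprod m m = 0 -> lprod n m != 0 ->
  exists A : 'M[R]_3,
    [/\ forall u v, lprod (u *m A) (v *m A) = lprod u v,
        E *m A = vec3 1 0 0, n *m A = vec3 0 1 1
      & m *m A = vec3 0 (lprod n m / 2) (- (lprod n m / 2))].
Proof.
move=> EE En Em nn mm; set g := lprod n m => g0.
pose eta := lorentz_gram R.
pose f2 := 2^-1 *: n + g^-1 *: m.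
pose f3 := 2^-1 *: n - g^-1 *: m.
pose B : 'M[R]_3 := \matrix_(i < 3) [:: E; f2; f3]`_i.
have BB : B *m eta *m B^T = eta.
  apply/matrixP => i j; rewrite lorentz_gramE !rowK /eta !mxE.
  have mn : lprod m n = g by rewrite lprodC.
  have [nE mE] : lprod n E = 0 /\ lprod m E = 0 by split; rewrite lprodC.
  by case: (ord3P i) => ->; case: (ord3P j) => ->;
    rewrite /= /f2 /f3 -?scaleNr ?lprodE ?EE ?En ?Em ?nn ?mm ?nE ?mE ?mn -/g
      ?mulr0n ?mulr1n; field; rewrite ?g0.
have BA : B *m (eta *m B^T *m eta) = 1%:M.
  by rewrite !mulmxA BB lorentz_gram_sqr.
have BB' : B^T *m eta *m B = eta.
  have : (B^T *m eta) *m (B *m eta) = 1%:M.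
    by apply: mulmx1C; rewrite mulmxA BB lorentz_gram_sqr.
  rewrite mulmxA => /(congr1 (mulmxr eta)) /=.
  by rewrite -mulmxA lorentz_gram_sqr mulmx1 mul1mx.
have rowBA i : row i B *m (eta *m B^T *m eta) = delta_mx 0 i.
  by rewrite -row_mul BA row1.
have EA : E *m (eta *m B^T *m eta) = vec3 1 0 0.
  have := rowBA 0; rewrite rowK /= => ->.
  by apply: row3P; rewrite !mxE.
have f2A : f2 *m (eta *m B^T *m eta) = vec3 0 1 0.
  have := rowBA 1; rewrite rowK /= => ->.
  by apply: row3P; rewrite !mxE.
have f3A : f3 *m (eta *m B^T *m eta) = vec3 0 0 1.
  have := rowBA 2; rewrite rowK /= => ->.
  by apply: row3P; rewrite !mxE.
exists (eta *m B^T *m eta); split => [u v|//||].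
- pose A := eta *m B^T *m eta.
  have etaT : eta^T = eta by rewrite /eta tr_diag_mx.
  have AA : A *m eta *m A^T = eta.
    rewrite /A !trmx_mul trmxK etaT -!mulmxA (mulmxA eta eta).
    rewrite lorentz_gram_sqr mul1mx !mulmxA.
    rewrite (_ : eta *m B^T *m eta *m B = eta *m (B^T *m eta *m B)).
      by rewrite BB' lorentz_gram_sqr mul1mx.
    by rewrite !mulmxA.
  transitivity ((u *m (A *m eta *m A^T) *m v^T) 0 0).
    by rewrite -lorentz_gramEr trmx_mul !mulmxA.
  by rewrite AA lorentz_gramEr.
- rewrite (_ : n = f2 + f3); last by rewrite /f2 /f3; apply: row3P; rewrite !mxE; field.
  by rewrite mulmxDl f2A f3A; apply: row3P; rewrite !mxE /=; ring.
- rewrite (_ : m = (g / 2) *: (f2 - f3)); last first.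
    by rewrite /f2 /f3; apply: row3P; rewrite !mxE; field.
  rewrite -scalemxAl mulmxBl f2A f3A; apply: row3P; rewrite !mxE /=; ring.
Qed.

(** * Differential equations on an interval *)

Lemma is_derive_coord (R : realType) (a : R -> 'rV[R]_3) (s : R) (i : 'I_3) :
  derivable a s 1 -> is_derive s 1 (fun x => a x 0 i) (derive1 a s 0 i).
Proof.
move=> da; apply: DeriveDef; first exact: (derivable_mxP _ _ _).1.
by rewrite derive1E derive_mx // mxE.
Qed.

(** The local form of [is_derive_0_is_cst], by the same use of the mean value
    theorem. *)
Lemma is_derive_interval_cst (R : realType) (I : set R) (f : R -> R) :
  is_interval I -> (forall s, I s -> is_derive s 1 f 0) ->
  forall s t, I s -> I t -> f s = f t.
Proof.
move=> hI df s t Is It.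
wlog st : s t Is It / s <= t.
  by move=> H; case: (leP s t) => [/H |/ltW /H]; [exact|move=> <-].
have sub x : x \in `[s, t]%R -> I x.
  by rewrite in_itv /= => xst; apply: (hI s t) => //; lra.
have [x xst||c _] := @MVT_segment R f (fun=> 0) s t st.
- by apply: df; apply: sub; move: xst; rewrite !in_itv /=; lra.
- by apply: derivable_within_continuous => x xst; have [] := df _ (sub _ xst).
by rewrite mul0r => /eqP; rewrite subr_eq0 => /eqP.
Qed.

Lemma is_derive_expRM (R : realType) (k x : R) :
  is_derive x 1 (fun s => expR (k * s)) (k * expR (k * x)).
Proof.
have d1 : is_derive x 1 (fun s : R => k * s) k.
  have := is_deriveZ k (is_derive_id x (1 : R)) => /is_derive_eq; apply.
  by rewrite /GRing.scale /= mulr1.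
have := is_derive1_comp (is_derive_expR (k * x)) d1.
by move=> /is_derive_eq; apply; rewrite mulrC.
Qed.

Lemma linear_ode (R : realType) (I : set R) (F F' : R -> R) (k : R) :
  open_interval I -> (forall s, I s -> is_derive s 1 F (F' s)) ->
  (forall s, I s -> F' s = k * F s) ->
  exists A, forall s, I s -> F s = A * expR (k * s).
Proof.
move=> [_ hI [s0 Is0]] dF F'E.
exists (F s0 * expR (- k * s0)) => s Is.
have <- : F s * expR (- k * s) = F s0 * expR (- k * s0).
  apply: (@is_derive_interval_cst R I (F * (fun x => expR (- k * x)))) => // x Ix.
  have dx := dF _ Ix; have ex := is_derive_expRM (- k) x.
  have := is_deriveM dx ex => /is_derive_eq; apply.
  by rewrite /GRing.scale /= F'E //; ring.
by rewrite -mulrA -expRD mulNr addNr expR0 mulr1.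
Qed.

Lemma is_derive_locally_zero (R : realType) (I : set R) (F : R -> R) (s d : R) :
  open I -> I s -> (forall x, I x -> F x = 0) -> is_derive s 1 F d -> d = 0.
Proof.
move=> oI Is F0 [_ <-].
have /near_eq_derive -> : \near s, F s = (cst 0 : R -> R) s.
  by apply: filterS (open_nbhs_nbhs (conj oI Is)) => x /F0.
by rewrite derive_cst.
Qed.

(** Since F' is nonzero, F cannot vanish identically on the open interval I; let
    F s0 <> 0, and likewise K t0 <> 0. Freezing s at s0 or t at t0 gives a linear
    equation for the other function, with constants k = F' s0 / F s0 for F and
    e k for K since e is its own inverse. *)
Lemma separated_exponentials (R : realType) (I J : set R)
    (F F' K K' : R -> R) (e : R) :
  open_interval I -> open_interval J -> e ^+ 2 = 1 ->
  (forall s, I s -> is_derive s 1 F (F' s)) ->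
  (forall t, J t -> is_derive t 1 K (K' t)) ->
  (forall s, I s -> F' s != 0) -> (forall t, J t -> K' t != 0) ->
  (forall s t, I s -> J t -> F' s * K t = e * F s * K' t) ->
  exists k A B, [/\ k != 0, A != 0, B != 0,
    forall s, I s -> F s = A * expR (k * s)
  & forall t, J t -> K t = B * expR (e * k * t)].
Proof.
move=> hI hJ e2 dF dK F'0 K'0 FK.
have [oI _ [s1 Is1]] := hI; have [oJ _ [t1 Jt1]] := hJ.
have e0 : e != 0 by rewrite -sqrf_eq0 e2 oner_eq0.
have [s0 Is0 Fs0] : exists2 s, I s & F s != 0.
  apply: contrapT => noF; have := F'0 _ Is1; apply/negP/negPn/eqP.
  apply: (is_derive_locally_zero oI Is1 _ (dF _ Is1)) => x Ix.
  by apply: contrapT => /eqP Fx; apply: noF; exists x.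
have [t0 Jt0 Kt0] : exists2 t, J t & K t != 0.
  apply: contrapT => noK; have := K'0 _ Jt1; apply/negP/negPn/eqP.
  apply: (is_derive_locally_zero oJ Jt1 _ (dK _ Jt1)) => x Jx.
  by apply: contrapT => /eqP Kx; apply: noK; exists x.
pose k := F' s0 / F s0.
have K'E t : J t -> K' t = e * k * K t.
  move=> Jt; apply: (mulfI e0); apply: (mulfI Fs0).
  rewrite mulrA (mulrC (F s0)) -FK // /k.
  transitivity (e ^+ 2 * (F' s0 * K t)); first by rewrite e2 mul1r.
  by field.
have F'E s : I s -> F' s = k * F s.
  move=> Is; apply: (mulIf Kt0); rewrite FK // K'E //.
  transitivity (e ^+ 2 * (k * F s * K t0)); first by ring.
  by rewrite e2 mul1r.
have [A FA] := linear_ode hI dF F'E.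
have [B KB] := linear_ode hJ dK K'E.
exists k, A, B; split=> //.
- by rewrite mulf_neq0 ?invr_eq0 ?F'0.
- by apply: contraNneq Fs0 => A0; rewrite FA // A0 mul0r.
- by apply: contraNneq Kt0 => B0; rewrite KB // B0 mul0r.
Qed.

Lemma exponential_velocity (R : realType) (I : set R) (a : R -> 'rV[R]_3)
    (E n : 'rV[R]_3) (A k : R) :
  open_interval I -> k != 0 -> (forall s, I s -> derivable a s 1) ->
  (forall s, I s -> derive1 a s = E + (A * expR (k * s)) *: n) ->
  exists p, forall s, I s -> a s = s *: E + expR (k * s) *: ((A / k) *: n) + p.
Proof.
move=> [_ hI [s0 Is0]] k0 da a'E.
exists (a s0 - s0 *: E - expR (k * s0) *: ((A / k) *: n)) => s Is.
suff H i : a s 0 i - s * E 0 i - expR (k * s) * (A / k * n 0 i) =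
    a s0 0 i - s0 * E 0 i - expR (k * s0) * (A / k * n 0 i).
  apply/rowP => i; rewrite !mxE -H; ring.
apply: (@is_derive_interval_cst R I (fun x => a x 0 i - x * E 0 i
  - expR (k * x) * (A / k * n 0 i))) => // x Ix.
have dx := is_derive_coord i (da _ Ix).
have ex := is_derive_expRM k x.
have := is_deriveB
  (is_deriveB dx
    (is_deriveM (is_derive_id x (1 : R)) (is_derive_cst (E 0 i) x (1 : R))))
  (is_deriveM ex (is_derive_cst (A / k * n 0 i) x (1 : R))).
move=> /is_derive_eq; apply.
by rewrite a'E // !mxE /GRing.scale /=; field.
Qed.

(** * The velocity of a pseudo-null curve *)

Lemma is_derive_lprod (R : realType) (u v : R -> 'rV[R]_3) (s : R) :
  derivable u s 1 -> derivable v s 1 ->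
  is_derive s 1 (fun x => lprod (u x) (v x))
    (lprod (derive1 u s) (v s) + lprod (u s) (derive1 v s)).
Proof.
move=> du dv.
have d i := is_deriveM (is_derive_coord i du) (is_derive_coord i dv).
have /is_derive_eq := is_deriveB (is_deriveD (d 0) (d 1)) (d 2); apply.
by rewrite /lprod /GRing.scale /=; ring.
Qed.

Lemma lprod_cst_derive1 (R : realType) (I : set R) (u v : R -> 'rV[R]_3) (c s : R) :
  open I -> I s -> derivable u s 1 -> derivable v s 1 ->
  (forall x, I x -> lprod (u x) (v x) = c) ->
  lprod (derive1 u s) (v s) + lprod (u s) (derive1 v s) = 0.
Proof.
move=> oI Is du dv uvc.
have := is_deriveB (is_derive_lprod du dv) (is_derive_cst c s (1 : R)).
rewrite subr0; apply: (is_derive_locally_zero oI Is) => x Ix.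
by rewrite !fctE uvc // subrr.
Qed.

(** The acceleration N satisfies N_z N' = N'_z N, so the quotients of its
    coordinates by N_z are constant; n is N normalized by n_z = 1. With this
    choice F and F' are the last coordinates of the velocity and of the
    acceleration. *)
Lemma pseudo_null_velocity (R : realType) (I : set R) (a : R -> 'rV[R]_3) :
  open_interval I -> pseudo_null I a ->
  exists (n T : 'rV[R]_3) (F F' : R -> R),
    [/\ lightlike n, lprod T n = 0 /\ lprod T T = 1,
        forall s, I s -> derive1 a s = T + F s *: n /\ derive1n 2 a s = F' s *: n,
        forall s, I s -> is_derive s 1 F (F' s)
      & forall s, I s -> F' s != 0].
Proof.
move=> [oI hI [s0 Is0]] [sa a1 a2].
(* Opaque names prevent unification from unfolding the iterated derivatives. *)
have [a' a'E] : exists a', a' = derive1 a by exists (derive1 a).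
have [N NE] : exists N, N = derive1 a' by exists (derive1 a').
have [N' N'E] : exists N', N' = derive1 N by exists (derive1 N).
have a''E : derive1n 2 a = N by rewrite NE a'E.
rewrite a''E -a'E in a1 a2 *.
have da' s : I s -> derivable a' s 1 by rewrite a'E => /(sa 1%N).
have dN s : I s -> derivable N s 1 by rewrite -a''E => /(sa 2%N).
have double0 (x : R) : x + x = 0 -> x = 0 by lra.
have NN s : I s -> lprod (N s) (N s) = 0 by case/a2.
have TN s : I s -> lprod (a' s) (N s) = 0.
  move=> Is; have := lprod_cst_derive1 oI Is (da' s Is) (da' s Is) a1.
  by rewrite -NE (lprodC (N s)) => /double0.
have TN' s : I s -> lprod (a' s) (N' s) = 0.
  move=> Is; have := lprod_cst_derive1 oI Is (da' s Is) (dN s Is) TN.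
  by rewrite -NE NN // add0r N'E.
have NN' s : I s -> lprod (N s) (N' s) = 0.
  move=> Is; have := lprod_cst_derive1 oI Is (dN s Is) (dN s Is) NN.
  by rewrite -N'E (lprodC (N' s)) => /double0.
have N2 s : I s -> N s 0 2 != 0 by move=> /a2; exact: lightlike_coord2_neq0.
have colin s i : I s -> N s 0 2 * N' s 0 i = N' s 0 2 * N s 0 i.
  move=> Is; have := @orth_lightlike_unit_colinear R (N s) (a' s) (N' s) (a2 _ Is)
    (TN _ Is) _ _ _.
  rewrite a1 // oner_eq0 lprodC NN' // lprodC TN' // => /(_ isT erefl erefl).
  by move=> /rowP /(_ i); rewrite !mxE.
have [n nE] : exists n, n = (N s0 0 2)^-1 *: N s0 by eexists.
have Nn s : I s -> N s = N s 0 2 *: n.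
  move=> Is; apply/rowP => i; rewrite nE !mxE.
  suff : N s 0 i * (N s 0 2)^-1 = N s0 0 i * (N s0 0 2)^-1.
    by move=> H; rewrite (mulrC _ (N s0 0 i)) -H mulrC divfK ?N2.
  apply: (@is_derive_interval_cst R I
    ((fun x => N x 0 i) * (fun x => (N x 0 2)^-1))) => // x Ix.
  have dN2 := is_deriveV (N2 _ Ix) (is_derive_coord 2 (dN _ Ix)).
  have /is_derive_eq := is_deriveM (is_derive_coord i (dN _ Ix)) dN2; apply.
  have : N' x 0 i = N' x 0 2 * N x 0 i / N x 0 2.
    by rewrite -colin // mulrC mulKf ?N2.
  rewrite /GRing.scale /= -N'E => ->.
  have := N2 _ Ix; move: (N x 0 i) (N x 0 2) (N' x 0 2) => y z w z0.
  by field.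
pose T := a' s0 - a' s0 0 2 *: n.
have nn : lprod n n = 0 by rewrite nE !lprodE NN // !mulr0.
have Tn0 : lprod (a' s0) n = 0 by rewrite nE !lprodE TN // mulr0.
exists n, T, (fun s => a' s 0 2), (fun s => N s 0 2); split.
- split=> // n0; have [_ []] := a2 _ Is0; rewrite Nn // n0 scaler0 //.
- by rewrite /T -scaleNr !lprodE (lprodC n) Tn0 nn a1 // !(mulr0, addr0).
- move=> s Is; split; last exact: Nn.
  suff H i : a' s 0 i - a' s 0 2 * n 0 i = a' s0 0 i - a' s0 0 2 * n 0 i.
    by apply/rowP => i; rewrite !mxE; have := H i; lra.
  apply: (@is_derive_interval_cst R I ((fun x => a' x 0 i)
    - (fun x => a' x 0 2) * (fun=> n 0 i))) => // x Ix.
  have /is_derive_eq := is_deriveB (is_derive_coord i (da' _ Ix))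
    (is_deriveM (is_derive_coord 2 (da' _ Ix)) (is_derive_cst (n 0 i) x (1 : R))).
  apply; rewrite -NE [in N x 0 i]Nn // !mxE /GRing.scale /=.
  by ring.
- by move=> s Is; rewrite NE; apply: is_derive_coord; apply: da'.
- exact: N2.
Qed.

(** * The mean curvature of a translation surface *)

Lemma derive1_translate (R : realType) (a : R -> 'rV[R]_3) (p : 'rV[R]_3) :
  derive1 (fun x => a x + p) = derive1 a.
Proof.
apply/funext => s; rewrite /derive1; congr (lim _).
by under eq_fun do rewrite opprD addrACA subrr addr0.
Qed.

(** The vector v - <u,v> u has squared length 1 - <u,v>^2. *)
Lemma spacelike_unit_lt1 (R : realType) (u v : 'rV[R]_3) :
  lprod u u = 1 -> lprod v v = 1 ->
  (forall x y : R, (x, y) <> (0, 0) ->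
     0 < lprod (x *: u + y *: v) (x *: u + y *: v)) ->
  lprod u v ^+ 2 < 1.
Proof.
move=> uu vv pos.
have /pos : (- lprod u v, 1 : R) <> (0, 0) by case=> _ /eqP; rewrite oner_eq0.
rewrite !lprodE uu vv (lprodC v); move: (lprod u v) => f; nra.
Qed.

(** The mixed term vanishes and E = G = 1, so that the mean curvature is, up to a
    factor that is nonzero on a spacelike surface, the determinant of u, v and
    p + q. *)
Lemma mean_curvature_arclength (R : realType) (X : R -> R -> 'rV[R]_3) (s t : R)
    (u v p q : 'rV[R]_3) :
  d_s X s t = u -> d_t X s t = v -> d_s (d_s X) s t = p ->
  d_t (d_s X) s t = 0 -> d_t (d_t X) s t = q ->
  lprod u u = 1 -> lprod v v = 1 -> lprod u v ^+ 2 < 1 ->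
  mean_curvature X s t = 0 -> lprod (lcross u v) (p + q) = 0.
Proof.
move=> Xs Xt Xss Xst Xtt uu vv uv1.
rewrite /mean_curvature /sfunde /sfundf /sfundg /unit_normal /fundE /fundF /fundG.
rewrite Xs Xt Xss Xst Xtt uu vv !lprodE.
(* Writing the zero vector as a multiple of itself lets bilinearity remove the
   mixed term. *)
rewrite -(scale0r (0 : 'rV[R]_3)) !lprodE.
move: (lprod u v) (lprod (lcross u v) p) (lprod (lcross u v) q) uv1 => f x y f1.
have W0 : 0 < 1 - f ^+ 2 by lra.
rewrite !(mul0r, mul1r, mulr0, mulr1, subr0) -mulrDr => /eqP.
rewrite oppr_eq0 !mulf_eq0 !invr_eq0 mulf_eq0 sqrtr_eq0 pnatr_eq0 /=.
by rewrite (gt_eqF W0) leNgt W0 /= orbF => /eqP.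
Qed.

Lemma maximal_translation_surface (R : realType) (I J : set R)
    (a b : R -> 'rV[R]_3) (s t : R) :
  maximal_surface I J (translation_surface a b) ->
  lprod (derive1 a s) (derive1 a s) = 1 ->
  lprod (derive1 b t) (derive1 b t) = 1 ->
  I s -> J t ->
  lprod (derive1 a s) (derive1 b t) ^+ 2 < 1 /\
  lprod (lcross (derive1 a s) (derive1 b t)) (derive1n 2 a s + derive1n 2 b t) = 0.
Proof.
move=> [sp H0] a1 b1 Is Jt.
have dsE : d_s (translation_surface a b) = fun s t => derive1 a s.
  by apply/funext => x; apply/funext => y; rewrite /d_s derive1_translate.
have dtE : d_t (translation_surface a b) = fun s t => derive1 b t.
  apply/funext => x; apply/funext => y; rewrite /d_t /translation_surface.
  by under eq_fun do rewrite addrC; rewrite derive1_translate.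
have f1 : lprod (derive1 a s) (derive1 b t) ^+ 2 < 1.
  apply: spacelike_unit_lt1 => // x y xy.
  by have := sp s t Is Jt x y xy; rewrite dsE dtE.
split; first exact: f1.
have ss : d_s (d_s (translation_surface a b)) s t = derive1n 2 a s.
  rewrite dsE; exact: erefl.
have st : d_t (d_s (translation_surface a b)) s t = 0.
  by rewrite dsE /d_t derive1_cst.
have Xtt : d_t (d_t (translation_surface a b)) s t = derive1n 2 b t.
  rewrite dtE /d_t; exact: erefl.
have s1 : d_s (translation_surface a b) s t = derive1 a s by rewrite dsE; exact: erefl.
have t1 : d_t (translation_surface a b) s t = derive1 b t by rewrite dtE; exact: erefl.
by apply: (mean_curvature_arclength s1 t1 ss st Xtt a1 b1 f1); exact: H0.
Qed.

(** * Classification *)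

Lemma unit_orthogonal_projection (R : realType) (n m T : 'rV[R]_3) :
  lprod n n = 0 -> lprod n m != 0 -> lprod T n = 0 -> lprod T T = 1 ->
  let E := T - (lprod T m / lprod n m) *: n in
  [/\ lprod E E = 1, lprod E n = 0 & lprod E m = 0].
Proof.
move=> nn nm Tn TT E; rewrite /E -scaleNr !lprodE (lprodC n T) nn Tn TT.
by split; rewrite ?(mulr0, addr0) // mulNr divfK // subrr.
Qed.

(** In the coordinates of [lorentz_frame], the vectors orthogonal to n and m
    are the multiples of (1,0,0). *)
Lemma unit_orthogonal_unique (R : realType) (n m E D : 'rV[R]_3) :
  lprod n n = 0 -> lprod m m = 0 -> lprod n m != 0 ->
  [/\ lprod E E = 1, lprod E n = 0 & lprod E m = 0] ->
  [/\ lprod D D = 1, lprod D n = 0 & lprod D m = 0] ->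
  exists2 e : R, e ^+ 2 = 1 & D = - e *: E.
Proof.
move=> nn mm nm [EE En Em] [DD Dn Dm].
have [A [AP EA nA mA]] := lorentz_frame EE En Em nn mm nm.
have inj (u : 'rV[R]_3) : u *m A = 0 -> u = 0.
  move=> uA; have u0 v : lprod u v = 0.
    by rewrite -AP uA /lprod !mxE !mul0r addr0 subr0.
  have := (u0 (vec3 1 0 0), u0 (vec3 0 1 0), u0 (vec3 0 0 1)).
  rewrite /lprod !mxE /= => -[[h0 h1] h2].
  by apply: row3P; rewrite mxE; lra.
set w := D *m A.
have w12 : w 0 1 - w 0 2 = 0.
  by have := Dn; rewrite -AP nA /lprod !mxE /= -/w; lra.
have w12' : w 0 1 + w 0 2 = 0.
  apply/(mulIf nm); have := Dm; rewrite -AP mA /lprod !mxE /= -/w; lra.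
have w1 : w 0 1 = 0 by lra.
have w2 : w 0 2 = 0 by lra.
exists (- w 0 0).
  have := DD; rewrite -AP -/w /lprod w1 w2; lra.
apply/eqP; rewrite -subr_eq0; apply/eqP/inj.
rewrite opprK mulmxBl -scalemxAl EA -/w; clearbody w.
by apply: row3P; rewrite !mxE /= ?w1 ?w2; ring.
Qed.

(** The velocities are adapted to a common frame (E, n, m) by shifting F and K by
    constants; the maximality equation is then F' K = e F K'. *)
Lemma maximal_pseudo_null_velocities (R : realType) (I J : set R)
    (a b : R -> 'rV[R]_3) :
  open_interval I -> open_interval J ->
  maximal_surface I J (translation_surface a b) ->
  pseudo_null I a -> pseudo_null J b ->
  exists (E n m : 'rV[R]_3) (e k A B : R),
    [/\ [/\ lprod E E = 1, lprod E n = 0 & lprod E m = 0],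
        [/\ lprod n n = 0, lprod m m = 0 & lprod n m != 0],
        [/\ e ^+ 2 = 1, k != 0, A != 0 & B != 0],
        forall s, I s -> derive1 a s = E + (A * expR (k * s)) *: n
      & forall t, J t -> derive1 b t = - e *: E + (B * expR (e * k * t)) *: m].
Proof.
move=> hI hJ hmax pa pb.
have [n [T [F [F' [nl [Tn TT] aE dF F'0]]]]] := pseudo_null_velocity hI pa.
have [m [S [K [K' [ml [Sm SS] bE dK K'0]]]]] := pseudo_null_velocity hJ pb.
have [_ _ [s0 Is0]] := hI; have [_ _ [t0 Jt0]] := hJ.
have [_ a1 _] := pa; have [_ b1 _] := pb.
have [nn _] := nl; have [mm _] := ml.
have nm : lprod n m != 0.
  apply/eqP => nm.
  have [+ _] := maximal_translation_surface hmax (a1 _ Is0) (b1 _ Jt0) Is0 Jt0.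
  rewrite (@lightlike_orth_gram R n m) //.
  - by rewrite a1 // b1 // mulr1 ltxx.
  - by have [-> _] := aE _ Is0; rewrite !lprodE Tn nn mulr0 addr0.
  - by have [-> _] := bE _ Jt0; rewrite !lprodE Sm mm mulr0 addr0.
pose x := lprod T m / lprod n m; pose y := lprod S n / lprod m n.
have hE := unit_orthogonal_projection nn nm Tn TT; rewrite -/x in hE.
have mn : lprod m n != 0 by rewrite lprodC.
have [DD Dm Dn] := unit_orthogonal_projection mm mn Sm SS; rewrite -/y in DD Dm Dn.
have [e e2 DE] := unit_orthogonal_unique nn mm nm hE (And3 DD Dn Dm).
move: hE DE; set E := T - x *: n => hE DE.
have aE' s : I s -> derive1 a s = E + (F s + x) *: n.
  move=> /aE[-> _]; rewrite /E; apply: row3P; rewrite !mxE; ring.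
have bE' t : J t -> derive1 b t = - e *: E + (K t + y) *: m.
  move=> /bE[-> _]; rewrite -DE; apply: row3P; rewrite !mxE; ring.
have dFx s : I s -> is_derive s 1 (F + cst x) (F' s).
  move=> /dF ds; have /is_derive_eq := is_deriveD ds (is_derive_cst x s (1 : R)).
  by apply; rewrite addr0.
have dKy t : J t -> is_derive t 1 (K + cst y) (K' t).
  move=> /dK dt; have /is_derive_eq := is_deriveD dt (is_derive_cst y t (1 : R)).
  by apply; rewrite addr0.
(* The Gram determinant of E, n and m is - <n,m> ^+ 2. *)
have det0 : lprod (lcross E m) n != 0.
  have [EE En Em] := hE.
  rewrite -sqrf_eq0 lcross_gram EE En Em nn mm (lprodC m n).
  by rewrite !(mulr0, mul0r, mul1r, addr0, subr0) expf_eq0.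
have FK s t : I s -> J t -> F' s * (K + cst y) t = e * (F + cst x) s * K' t.
  move=> Is Jt.
  have [_] := maximal_translation_surface hmax (a1 _ Is) (b1 _ Jt) Is Jt.
  have [_ ->] := aE _ Is; have [_ ->] := bE _ Jt.
  rewrite aE' // bE' // lcross_frame => /eqP; rewrite mulf_eq0 (negPf det0) orbF.
  rewrite /cst !fctE => /eqP; lra.
have [k [A [B [k0 A0 B0 FA KB]]]] :=
  separated_exponentials hI hJ e2 dFx dKy F'0 K'0 FK.
exists E, n, m, e, k, A, B; split=> //.
- by move=> s Is; rewrite aE' // -FA.
- by move=> t Jt; rewrite bE' // -KB.
Qed.

Theorem theorem3p3 (R : realType) (I J : set R) (alpha beta : R -> 'rV[R]_3)
  (hI : open_interval I) (hJ : open_interval J)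
  (hgen : generating_curves I J alpha beta)
  (hmax : maximal_surface I J (translation_surface alpha beta))
  (halpha : pseudo_null I alpha) (hbeta : pseudo_null J beta) :
  [\/ planar_surface I J (translation_surface alpha beta),
      same_curve I alpha J beta
    | exists (Phi : 'rV[R]_3 -> 'rV[R]_3) (k b w1 w2 w3 : R) (I' J' : set R),
        [/\ rigid_motion Phi,
            k <> 0 /\ w2 - w3 <> 0,
            w1 = b * (w3 - w2) /\ b ^+ 2 * (w2 - w3) + w2 + w3 = 0,
            same_curve I (Phi \o alpha) I'
              (fun s => expR (k * s) *: vec3 0 1 1 + s *: vec3 1 b b)
          & same_curve J (Phi \o beta) J'
              (fun t => expR (k * t) *: vec3 w1 w2 w3 - t *: vec3 1 b b)]].
Proof.
apply: Or33.
have [E [n [m [e [k [A [B [[EE En Em] [nn mm nm] [e2 k0 A0 B0] aE bE]]]]]]]] :=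
  maximal_pseudo_null_velocities hI hJ hmax halpha hbeta.
have e0 : e != 0 by rewrite -sqrf_eq0 e2 oner_eq0.
have ek0 : e * k != 0 by rewrite mulf_neq0.
have [sa _ _] := halpha; have [sb _ _] := hbeta.
have [p pE] := exponential_velocity (a := alpha) hI k0 (sa 0%N) aE.
have [q qE] := exponential_velocity (a := beta) hJ ek0 (sb 0%N) bE.
set n' := (A / k) *: n in pE; set m' := (B / (e * k)) *: m in qE.
have n'm' : lprod n' m' != 0.
  by rewrite !lprodE !mulf_neq0 ?invr_eq0.
have [M [MP EM nM mM]] : exists M : 'M[R]_3,
    [/\ forall u v, lprod (u *m M) (v *m M) = lprod u v,
        E *m M = vec3 1 0 0, n' *m M = vec3 0 1 1
      & m' *m M = vec3 0 (lprod n' m' / 2) (- (lprod n' m' / 2))].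
  by apply: lorentz_frame => //; rewrite !lprodE ?En ?Em ?nn ?mm ?mulr0.
clearbody n' m'; set h := lprod n' m' / 2 in mM.
have h0 : h != 0 by rewrite mulf_neq0 // invr_eq0 pnatr_eq0.
(* With b = 0 the equations on w say that it is a multiple of (0, 1, - 1). *)
exists (fun u => u *m M + 0), k, 0, 0, h, (- h), I, [set t | J (e * t)].
split.
- by exists M, 0; split.
- by split; [exact/eqP|rewrite opprK -mulr2n; apply/eqP; rewrite mulrn_eq0].
- by split; ring.
- exists 1, 0, (- (p *m M)); split; first by left.
  + by move=> s; rewrite mul1r addr0.
  + move=> s Is; rewrite mul1r addr0 /= addr0 pE // !mulmxDl -!scalemxAl EM nM.
    by apply: row3P; rewrite !mxE; ring.
(* In the parameter e t the exponent of beta becomes k, and its linear part the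
   opposite of that of alpha. *)
- exists e, 0, (- (q *m M)); split.
  + by have /eqP := e2; rewrite sqrf_eq1 => /orP[/eqP|/eqP]; [left|right].
  + have ee t : e * (e * t) = t by rewrite mulrA -expr2 e2 mul1r.
    by move=> t; rewrite addr0 /mkset ee.
  + move=> t Jt; rewrite addr0 /= addr0 qE // !mulmxDl -!scalemxAl EM mM.
    by rewrite mulrA (mulrC k); apply: row3P; rewrite !mxE /=; ring.
Qed.
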